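(* Let $G=(X,E,r)$ be an irreducible finite weighted directed graph. Let $+1,-1\in E$ be a pair of mutually reverse edges between two distinct vertices, both of nonvanishing weight, and assume that this edge is not a bridge. For each $x\in X$ define the vector $$\boldsymbol{\tau}_x=\begin{pmatrix}\tau_x^{\,\mathrm{del}\,\{+1,-1\}}\\[2pt] \tau_x^{\,\mathrm{del}\,\{-1\},\ \mathrm{con}\,\{+1\}}\\[2pt] \tau_x^{\,\mathrm{del}\,\{+1\},\ \mathrm{con}\,\{-1\}}\end{pmatrix}\in\mathbb{R}^3 .$$ Then the vectors $\boldsymbol{\tau}_x$, $x\in X$, are coplanar, i.e. they all lie in a common two-dimensional linear subspace of $\mathbb{R}^3$.
   Context: A weighted directed graph $G=(X,E,r)$ consists of a finite vertex set $X$, a set of directed edges $E\subseteq X\times X$ (an ordered pair $(x,y)\in E$ is an edge $x\to y$ with source $x$ and target $y$), and a positive weight $r:E\to\mathbb{R}_{>0}$. The edges $x\to y$ and $y\to x$ may carry different weights. For a subset $S\subseteq E$ write $r(S)=\prod_{e\in S}r(e)$, with $r(\varnothing)=1$. Irreducible means that there is a directed path between any two vertices, in each direction. ''Not a bridge'' means that removing both directions $+1,-1$ does not disconnect the graph into two subgraphs. A rooted spanning tree $T_x$ with root $x$ is a set of directed edges forming (when orientations are forgotten) a tree connecting all vertices of $X$, each edge being directed along the unique path leading to the root $x$. Equivalently, it is a spanning acyclic set of edges in which every vertex other than $x$ has exactly one outgoing edge and $x$ has none. In particular, it never contains both directions of an edge. For disjoint subsets $A,B\subseteq E$, the conditioned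 rooted spanning tree polynomial is $$\tau_x^{\,\mathrm{del}\,A,\ \mathrm{con}\,B}=\sum_{\substack{T_x:\ A\cap T_x=\varnothing,\\ B\subseteq T_x}}r(T_x),$$ the sum being over all spanning trees $T_x\subseteq E$ rooted at $x$ that contain no edge of $A$ and contain all edges of $B$ (an empty sum is $0$). When $B=\varnothing$ one writes $\tau_x^{\,\mathrm{del}\,A}$. *)

(* Defs.v *)
(* Mathematical Components, with the real numbers of MathComp-Analysis. *)
From mathcomp Require Import all_boot all_order all_algebra.
From mathcomp Require Import boolp reals.

Set Implicit Arguments.
Unset Strict Implicit.
Unset Printing Implicit Defensive.

Import Order.TTheory GRing.Theory Num.Theory.
Local Open Scope ring_scope.

(* The edge (y, z) is y -> z; only the values of [weight] on [edges] matter. *)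
Record wdigraph (R : realType) (X : finType) := WDigraph {
  edges : {set X * X};
  weight : X * X -> R;
  weight_gt0 : {in edges, forall e, 0 < weight e}
}.

Section EdgeSets.
Variable X : finType.
Implicit Types (S T : {set X * X}) (x y z : X).

Definition arc S : rel X := [rel y z | (y, z) \in S].

Definition adj S : rel X := [rel y z | ((y, z) \in S) || ((z, y) \in S)].

Definition strongly_connected S := forall y z, connect (arc S) y z.

Definition weakly_connected S := forall y z, connect (adj S) y z.

(* Cycles of the simple graph [adj S] have length at least 3. *)
Definition undirected_tree S :=
  [/\ irreflexive (adj S),
      weakly_connected S &
      forall c : seq X, ucycle (adj S) c -> (size c <= 2)%N].

(* In a tree there is exactly one simple path y :: p from y to x, so the last
   clause says that each y -> z in T is the first step of that path. In
   particular x has no outgoing edge, and T never contains both (y, z) and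
   (z, y). *)
Definition rooted_spanning_tree x T :=
  undirected_tree T /\
  forall y z, (y, z) \in T ->
    forall p : seq X, path (adj T) y p -> uniq (y :: p) -> last y p = x ->
      ohead p = Some z.

End EdgeSets.

Section TreePolynomials.
Variables (R : realType) (X : finType) (G : wdigraph R X).

Definition irreducible_graph := strongly_connected (edges G).

Definition not_bridge (a b : X) :=
  weakly_connected (edges G :\: [set (a, b); (b, a)]).

Definition tree_poly (x : X) (A B : {set X * X}) : R :=
  \sum_(T : {set X * X} |
      [&& T \subset edges G, `[< rooted_spanning_tree x T >],
          [disjoint A & T] & B \subset T])
    \prod_(e in T) weight G e.

Definition tree_vec (p m : X * X) (x : X) : 'cV[R]_3 :=
  \col_(i < 3)
    tnth [tuple tree_poly x [set p; m] set0;
                tree_poly x [set m] [set p];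
                tree_poly x [set p] [set m]] i.

End TreePolynomials.

(* Main.v *)
Require Import Defs.
From mathcomp Require Import all_boot all_order all_algebra.
From mathcomp Require Import boolp reals.

Set Implicit Arguments.
Unset Strict Implicit.
Unset Printing Implicit Defensive.

Import Order.TTheory GRing.Theory Num.Theory.
Local Open Scope ring_scope.

(** Write u0, u1, u2 for the root-indexed tree sums of the graph without +1 and
    -1, without -1 only, and without +1 only. Splitting the trees counted by u1
    according to whether they contain +1, and those counted by u2 according to
    whether they contain -1 ([tree_poly_del_con]), the three coordinates of
    tau_x are u0 x, u1 x - u0 x and u2 x - u0 x. So it is enough to find a
    nontrivial linear relation between the functions u0, u1, u2 on X.

    By the Markov chain tree theorem ([tree_sum_balance]) each of them is a
    stationary measure of its own graph. Look at all three with the edge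
    deleted, that is, apply to them the linear operator L measuring the net
    inflow at every vertex in the graph without +1 and -1. Then L u0 = 0, while
    L u1 and L u2 only miss the flow along the single arc that is deleted, so
    both are multiples of the same function, the indicator of one end point
    minus the indicator of the other ([net_inflow_add_arc]). Hence a nontrivial
    combination v of u1 and u2 satisfies L v = 0.

    If u0 vanishes everywhere, the relation is u0 = 0. Otherwise u0 x0 <> 0 for
    some x0, so some tree rooted at x0 survives the deletion and every vertex
    reaches x0 ([tree_sum_neq0]). A stationary measure that vanishes at such a
    vertex is zero ([stationary_eq0]), and applying this to
    u0 x0 * v - v x0 * u0 gives the relation ([dependent_measures]).

    Trees are handled through parent functions: a spanning tree rooted at x is
    the same as a map f fixing x such that the iterates of f lead from every
    vertex to x ([spanning_tree_parent_fun], [parent_fun_spanning_tree]). *)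

(** * Rooted spanning trees as parent functions *)

Section ParentFunctions.
Variable X : finType.
Implicit Types (f g : {ffun X -> X}) (x y z : X) (T : {set X * X}).

Definition reaches f x := [forall y, fconnect f y x].

(** The root is made a fixed point so that a tree determines its parent
    function. *)
Definition parent_fun x f := (f x == x) && reaches f x.

Definition tree_arcs x f : {set X * X} :=
  [set e | (e.1 != x) && (e.2 == f e.1)].

Lemma mem_tree_arcs x f y z :
  ((y, z) \in tree_arcs x f) = (y != x) && (z == f y).
Proof. by rewrite inE. Qed.

Lemma tree_arcs_inj x : {in parent_fun x &, injective (tree_arcs x)}.
Proof.
move=> f g /andP[/eqP fx _] /andP[/eqP gx _] eqT; apply/ffunP => y.
have [->|yx] := eqVneq y x; first by rewrite fx gx.
have: (y, f y) \in tree_arcs x g by rewrite -eqT mem_tree_arcs yx eqxx.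
by rewrite mem_tree_arcs yx => /eqP.
Qed.

(** The depth of a vertex, its distance to the root under [f], decreases by one
    along every arc. On a cycle of length at least 3, the two neighbours of a
    deepest vertex would both be its parent. A simple path that starts by going
    down to a child can never turn back up, since it would have to retrace its
    last step, so it does not end at the root. *)
Lemma parent_fun_spanning_tree x f :
  parent_fun x f -> rooted_spanning_tree x (tree_arcs x f).
Proof.
case/andP=> /eqP fx /forallP fr; set T := tree_arcs x f.
pose depth y := findex f y x.
have depthE y z : (y, z) \in T -> depth y = (depth z).+1.
  by rewrite mem_tree_arcs => /andP[yx /eqP->];
     rewrite /depth fconnect_findex // eq_sym.
have arc_fun y z t : (y, z) \in T -> (y, t) \in T -> z = t.
  by rewrite !mem_tree_arcs => /andP[_ /eqP->] /andP[_ /eqP->].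
have up y : connect (adj T) y x.
  have /iter_findex := fr y; move: (findex f y x) => n; elim: n y => [|n IHn] y.
    by move=> /= ->.
  have [->//|yx] := eqVneq y x.
  rewrite iterSr => /IHn; apply: connect_trans; apply: connect1.
  by apply/orP; left; rewrite mem_tree_arcs yx eqxx.
split; first split.
- by move=> y; apply/negP => /orP[] /depthE/n_Sn.
- move=> y z; apply: connect_trans (up y) _.
  rewrite (_ : connect _ x z = connect (adj T) z x) //.
  by apply: sym_connect_sym => u v; rewrite /adj /= orbC.
- move=> c cT; rewrite leqNgt; apply/negP => c3.
  have [y0 y0c] : exists y0, y0 \in c
    by case: (c) c3 => // y0 ? _; exists y0; rewrite mem_head.
  case: (@arg_maxnP _ y0 (mem c) depth y0c) => y yc ymax.
  case: (rot_to yc) => i c' def_c.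
  move: cT c3; rewrite -(rot_ucycle i) -(size_rot i) def_c => /andP[cT Uc].
  have {}ymax z : z \in c' -> (depth z <= depth y)%N.
    by move=> zc; apply: ymax; rewrite /= -(mem_rot i) def_c inE zc orbT.
  have nbr z : z \in c' -> adj T y z -> (y, z) \in T.
    by move=> /ymax zy /orP[//|/depthE zE]; rewrite zE ltnn in zy.
  case: c' def_c cT Uc ymax nbr => [|z c'] // _ cT Uc _ nbr.
  case/lastP: c' cT Uc nbr => // c' w.
  rewrite /= rcons_path last_rcons => /and3P[yz _ wy] Uc nbr _.
  have zT : (y, z) \in T by apply: nbr yz; rewrite mem_head.
  have wT : (y, w) \in T.
    apply: nbr; first by rewrite inE mem_rcons mem_head orbT.
    by case/orP: wy => wy; apply/orP; [right|left].
  move: Uc; rewrite (arc_fun _ _ _ zT wT) /= mem_rcons mem_head.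
  by rewrite andbF.
- move=> y z yz p.
  have down q u v : (u, v) \in T -> path (adj T) u q -> uniq (u :: q) ->
      v \notin q -> (depth u <= depth (last u q))%N.
    elim: q u v => [|t q IHq] u v uv //= /andP[ut tq] /andP[uq Utq].
    rewrite inE negb_or => /andP[vt vq].
    case/orP: ut => [ut|tu]; first by rewrite (arc_fun _ _ _ uv ut) eqxx in vt.
    have := IHq t u tu tq Utq; rewrite (depthE _ _ tu) => /(_ _)/ltnW; apply.
    by move: uq; rewrite inE negb_or => /andP[].
  have depthx : depth x = 0%N by rewrite /depth findex0.
  case: p => [|t p] /=.
    by move=> _ _ yx; move: (depthE _ _ yz); rewrite yx depthx.
  move=> /andP[yt tp] /andP[yp Up] lastx; congr Some.
  case/orP: yt => [yt|ty]; first exact: arc_fun yt yz.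
  have := down p t y ty tp Up; rewrite lastx depthx (depthE _ _ ty).
  by move: yp; rewrite inE negb_or => /andP[_ yp] /(_ yp).
Qed.

(** On a simple path to the root every step follows an arc of [T] forwards: if
    a step from [y] to [z] used the arc from [z] to [y], the rest of the path
    would be the simple path from [z] to the root, and its first step would
    have to return to [y]. *)
Lemma spanning_tree_parent_fun x T :
  rooted_spanning_tree x T -> exists2 f, parent_fun x f & T = tree_arcs x f.
Proof.
case=> [[_ conT _] dirT].
have fwd y p : path (adj T) y p -> uniq (y :: p) -> last y p = x ->
    path [rel u v | (u, v) \in T] y p.
  elim: p y => [|z p IHp] y //= /andP[yz zp] /andP[yp Up] lastx.
  rewrite (IHp z) // andbT; case/orP: yz => // zy.
  have /=:= dirT _ _ zy _ zp Up lastx.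
  case: (p) yp => [|t q] //=; rewrite !inE => /negP yp [ty]; case: yp.
  by rewrite ty eqxx orbT.
have pathT y : exists p, [/\ path (adj T) y p, uniq (y :: p) & last y p = x].
  have /connectP[p yp ->] := conT y x.
  by case/shortenP: yp => q yq Uq _; exists q.
have arc_fun y z t : (y, z) \in T -> (y, t) \in T -> z = t.
  move=> yz yt; have [p [yp Up lastx]] := pathT y.
  move: (dirT _ _ yz _ yp Up lastx).
  by rewrite (dirT _ _ yt _ yp Up lastx) => -[].
have xT z : (x, z) \notin T by apply/negP => /dirT/(_ [::] isT isT erefl).
pose f := [ffun y => odflt y [pick z | (y, z) \in T]].
have fE y z : (y, z) \in T -> f y = z.
  move=> yz; rewrite ffunE; case: pickP => [t yt|/(_ z)]; last by rewrite yz.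
  exact: arc_fun yt yz.
have fx : f x = x.
  by rewrite ffunE; case: pickP => // z xz; have := xT z; rewrite xz.
have fconT y : fconnect f y x.
  have [p [yp Up lastx]] := pathT y; apply/connectP; exists p => //.
  by apply: sub_path (fwd _ _ yp Up lastx) => u v /= /fE->.
exists f; first by rewrite /parent_fun fx eqxx; apply/forallP.
apply/setP => -[y z]; rewrite mem_tree_arcs.
have [->|yx] := eqVneq y x; first exact/negbTE.
apply/idP/eqP => [/fE->//|->].
have [[|t p] [yp Up lastx]] := pathT y; first by rewrite -lastx eqxx in yx.
by have /= /andP[yt _] := fwd _ _ yp Up lastx; rewrite (fE _ _ yt).
Qed.

(** * Functional graphs with a marked vertex on their cycle *)

Definition reroute f x z : {ffun X -> X} :=
  [ffun v => if v == x then z else f v].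

(** A path is only followed until it first meets [x], so it never uses the
    image of [x]. *)
Lemma reroute_reaches f x z : reaches f x -> reaches (reroute f x z) x.
Proof.
move=> /forallP fr; apply/forallP => y; set g := reroute f x z.
have /iter_findex := fr y; move: (findex f y x) => n.
elim: n y => [|n IHn] y; first by move=> /= ->.
have [->//|yx] := eqVneq y x; rewrite iterSr => /IHn.
apply: connect_trans; apply: connect1.
by rewrite /= ffunE (negPf yx).
Qed.

(** The vertex preceding [y] on the cycle: among the preimages of [y], it is
    the one on the orbit of [y], where [f] is injective. *)
Lemma last_before_root f y :
  reaches f y -> exists2 x, (f x == y) && reaches f x &
    forall x', (f x' == y) && reaches f x' -> x' = x.
Proof.
move=> /forallP fr.
have cyc : fconnect f (f y) y := fr _.
have inj : {in orbit f y &, injective f} by apply/(orbitPcycle 2 5).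
have reachP x : f x = y -> reaches f x = (x \in orbit f y).
  move=> fx; rewrite -fconnect_orbit; apply/forallP/idP => [/(_ y)//|yx v].
  exact: connect_trans (fr v) yx.
pose x := iter (findex f (f y) y) f y.
have fx : f x = y by rewrite /x -iterS iterSr iter_findex.
have xo : x \in orbit f y by rewrite -fconnect_orbit fconnect_iter.
exists x; first by rewrite reachP // fx eqxx.
move=> x' /andP[/eqP fx']; rewrite reachP // => x'o.
by apply: inj => //; rewrite fx fx'.
Qed.

End ParentFunctions.

(** * Tree sums and the Markov chain tree theorem *)

Section TreeSums.
Variables (K : comPzRingType) (X : finType).
Implicit Types (w : X -> X -> K) (f g : {ffun X -> X}).

Definition tree_sum w x : K :=
  \sum_(f : {ffun X -> X} | parent_fun x f) \prod_(v | v != x) w v (f v).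

(** When all vertices reach [x] under [f], the arc out of [x] closes the only
    cycle of [f]; cutting it leaves a spanning tree rooted at [x]. *)
Lemma sum_rerouted w x z :
  \sum_(f : {ffun X -> X} | (f x == z) && reaches f x) \prod_v w v (f v) =
  w x z * tree_sum w x.
Proof.
rewrite mulr_sumr (reindex_onto (fun f : {ffun X -> X} => reroute f x z)
  (fun f => reroute f x x)); last first.
  move=> f /andP[/eqP fx _]; apply/ffunP => v; rewrite !ffunE.
  by case: eqVneq => // ->.
apply: eq_big => [f|f _].
  rewrite ffunE eqxx eqxx /=; apply/andP/andP => [[fr /eqP fE]|[/eqP fx fr]].
    rewrite -fE; split; first by rewrite ffunE eqxx.
    exact: reroute_reaches.
  split; first exact: reroute_reaches.
  by apply/eqP/ffunP => v; rewrite !ffunE; case: eqVneq => // ->.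
rewrite (bigD1 x) //= ffunE eqxx; congr (_ * _).
by apply: eq_bigr => v /negPf vx; rewrite ffunE vx.
Qed.

Lemma tree_sum_neq0 w x : tree_sum w x != 0 ->
  forall y, connect [rel y z | w y z != 0] y x.
Proof.
move=> s0 y; have [f /andP[/andP[_ /forallP fr] wf]|no_f] :=
    pickP (fun f => parent_fun x f && [forall (v | v != x), w v (f v) != 0]);
    last first.
  case/eqP: s0; apply: big1 => f fP; move: (no_f f); rewrite fP /=.
  move=> /negbT/forall_inPn[v vx]; rewrite negbK => /eqP wv0.
  by rewrite (bigD1 v) //= wv0 mul0r.
have /iter_findex := fr y; move: (findex f y x) => n.
elim: n y => [|n IHn] y; first by move=> /= ->.
have [->//|yx] := eqVneq y x; rewrite iterSr => /IHn.
by apply: connect_trans; apply: connect1; apply: (forall_inP wf).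
Qed.

Definition outflow w y := \sum_z w y z.

(** This is the generator of the Markov chain with rates [w], acting on
    measures; a loop at [y] contributes equally to both terms. *)
Definition net_inflow w (u : X -> K) y :=
  \sum_x u x * w x y - u y * outflow w y.

(** Both terms of the net inflow are the sum, over the functional graphs in
    which all vertices reach [y], of the product of all weights: the outflow
    groups these graphs by the image of [y], the inflow by the vertex that
    precedes [y] on the cycle. *)
Lemma tree_sum_balance w y : net_inflow w (tree_sum w) y = 0.
Proof.
apply/eqP; rewrite subr_eq0; apply/eqP.
transitivity (\sum_(f : {ffun X -> X} | reaches f y) \prod_v w v (f v)).
  under eq_bigr do rewrite mulrC -sum_rerouted.
  rewrite (exchange_big_dep (fun f : {ffun X -> X} => reaches f y)) /=
    => [|x f _ /andP[/eqP <-]].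
    apply: eq_bigr => f /last_before_root[x xP xU].
    rewrite (bigD1 x) //= [X in _ + X]big1 ?addr0 // => x' /andP[/xU-> ].
    by rewrite eqxx.
  move=> /forallP fr; apply/forallP => v; apply: connect_trans (fr v) _.
  exact: fconnect1.
rewrite mulrC mulr_suml.
rewrite (partition_big (fun f : {ffun X -> X} => f y) xpredT) //=.
apply: eq_bigr => z _; rewrite -sum_rerouted.
by apply: eq_bigl => f; rewrite andbC.
Qed.

(** With respect to its own rates [w'], the tree sum is balanced; [w] only
    lacks the flow along the arc from [a] to [b]. *)
Lemma net_inflow_add_arc w w' a b s :
  (forall x y, w' x y = w x y + s *+ ((x, y) == (a, b))) ->
  exists j, forall y,
    net_inflow w (tree_sum w') y = j * ((y == a)%:R - (y == b)%:R).
Proof.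
move=> w'E; set u := tree_sum w'; exists (u a * s) => y.
have := tree_sum_balance w' y; rewrite /net_inflow /outflow -/u.
have -> : \sum_x u x * w' x y = \sum_x u x * w x y + u a * s * (y == b)%:R.
  under eq_bigr do rewrite w'E mulrDr.
  rewrite big_split /=; congr (_ + _).
  rewrite (bigD1 a) //= big1 ?addr0 => [|x /negPf xa].
    by rewrite xpair_eqE eqxx /= -mulrA mulr_natr.
  by rewrite xpair_eqE xa mulr0.
have -> : u y * (\sum_z w' y z) = u y * (\sum_z w y z) + u a * s * (y == a)%:R.
  under eq_bigr do rewrite w'E.
  rewrite big_split /= mulrDr; congr (_ + _).
  rewrite (bigD1 b) //= big1 ?addr0 => [|z /negPf zb].
    rewrite xpair_eqE eqxx andbT -mulrA mulr_natr.
    by have [->|_] := eqVneq y a; rewrite // !mulr0n !mulr0.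
  by rewrite xpair_eqE zb andbF.
move=> /eqP; rewrite subr_eq0 => /eqP/(canRL (addrK _))->.
by rewrite mulrBr addrAC [_ + _ * _]addrC addrK.
Qed.

End TreeSums.

(** * Uniqueness of stationary measures *)

Section StationaryMeasures.
Variables (R : realDomainType) (X : finType) (w : X -> X -> R).
Hypothesis w_ge0 : forall x y, 0 <= w x y.
Implicit Types (u v : X -> R).

Lemma sum_net_inflow u : \sum_y net_inflow w u y = 0.
Proof.
rewrite sumrB exchange_big /=; apply/eqP; rewrite subr_eq0; apply/eqP.
by apply: eq_bigr => x _; rewrite mulr_sumr.
Qed.

(** By the triangle inequality the net inflow of the absolute value is
    nonnegative everywhere, and its total over all vertices is zero. *)
Lemma net_inflow_norm u :
  (forall y, net_inflow w u y = 0) ->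
  forall y, net_inflow w (fun x => `|u x|) y = 0.
Proof.
move=> u0 y; pose p x := `|u x|.
have p_ge0 z : 0 <= net_inflow w p z.
  have /eqP := u0 z; rewrite subr_eq0 subr_ge0 => /eqP uz.
  have out_ge0 : 0 <= outflow w z by apply: sumr_ge0.
  rewrite /p -(ger0_norm out_ge0) -normrM -uz.
  apply: le_trans (ler_norm_sum _ _ _) _; apply: ler_sum => x _.
  by rewrite normrM (ger0_norm (w_ge0 _ _)).
have /eqP := sum_net_inflow p; rewrite psumr_eq0 // => /allP/(_ y).
by rewrite mem_index_enum => /(_ isT)/eqP.
Qed.

(** For a nonnegative stationary measure that vanishes at [z], all terms of the
    inflow at [z] vanish, hence so does the measure at every vertex with an arc
    to [z]. The zero set thus spreads backwards from [x0] to the whole graph. *)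
Lemma stationary_eq0 u (x0 : X) :
  (forall y, connect [rel y z | w y z != 0] y x0) ->
  (forall y, net_inflow w u y = 0) -> u x0 = 0 -> forall y, u y = 0.
Proof.
move=> reach /net_inflow_norm u0 ux0.
have back y z : w y z != 0 -> u z = 0 -> u y = 0.
  move=> wyz uz; have /eqP := u0 z.
  rewrite /net_inflow uz normr0 mul0r subr0 psumr_eq0 => [|x _];
    last exact: mulr_ge0.
  move=> /allP/(_ y); rewrite mem_index_enum => /(_ isT) /=.
  by rewrite mulf_eq0 normr_eq0 (negPf wyz) orbF => /eqP.
move=> y; have /connectP[p] := reach y.
elim: p y => [|z p IHp] y /=; first by move=> _ <-.
by move=> /andP[wyz zp] /(IHp _ zp); apply: back.
Qed.

Lemma net_inflow_linear u v c d y :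
  net_inflow w (fun x => c * u x + d * v x) y =
  c * net_inflow w u y + d * net_inflow w v y.
Proof.
rewrite /net_inflow !mulrBr addrACA -opprD mulrDl !mulrA; congr (_ - _).
rewrite !mulr_sumr -big_split /=; apply: eq_bigr => x _.
by rewrite mulrDl !mulrA.
Qed.

(** The net inflow maps the span of [u], [u1], [u2] into the line of [D], and
    by [stationary_eq0] its kernel is the line of [u], so the span has dimension
    at most two. *)
Lemma dependent_measures u u1 u2 (x0 : X) (j1 j2 : R) (D : X -> R) :
  (forall y, connect [rel y z | w y z != 0] y x0) -> u x0 != 0 ->
  (forall y, net_inflow w u y = 0) ->
  (forall y, net_inflow w u1 y = j1 * D y) ->
  (forall y, net_inflow w u2 y = j2 * D y) ->
  exists c : R * R * R, c != 0 /\
    forall y, c.1.1 * u y + c.1.2 * u1 y + c.2 * u2 y = 0.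
Proof.
move=> reach ux0 u_st u1E u2E.
have [d1 [d2 [d_neq0 dj]]] : exists d1 d2 : R,
    (d1, d2) != 0 /\ d1 * j1 + d2 * j2 = 0.
  have [j10|j1N] := eqVneq j1 0.
    by exists 1, 0; rewrite xpair_eqE oner_eq0 j10 mulr0 mul0r addr0.
  by exists (- j2), j1; rewrite xpair_eqE (negPf j1N) andbF mulNr mulrC addNr.
pose v x := d1 * u1 x + d2 * u2 x.
have v_st y : net_inflow w v y = 0.
  by rewrite net_inflow_linear u1E u2E !mulrA -mulrDl dj mul0r.
(* The combination u x0 * v - v x0 * u is stationary and vanishes at x0. *)
exists (- v x0, u x0 * d1, u x0 * d2); split.
  move: d_neq0; apply: contraNneq => -[_ /eqP + /eqP].
  by rewrite !mulf_eq0 !(negPf ux0) => /eqP-> /eqP->.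
move=> y /=; rewrite -addrA -!mulrA -mulrDr.
apply: (@stationary_eq0 (fun y => - v x0 * u y + u x0 * v y) x0 reach) => [z|].
  by rewrite net_inflow_linear u_st v_st !mulr0 addr0.
by rewrite mulrC mulrN addNr.
Qed.

End StationaryMeasures.

(** * Deletion and contraction in tree polynomials *)

Section Polynomials.
Variables (R : realType) (X : finType) (G : wdigraph R X).
Implicit Types (F A B : {set X * X}).

Definition weight_on F y z : R := if (y, z) \in F then weight G (y, z) else 0.

Lemma weight_on_ge0 F y z : F \subset edges G -> 0 <= weight_on F y z.
Proof.
rewrite /weight_on => /subsetP FE; case: ifP => // /FE yz.
by rewrite ltW // weight_gt0.
Qed.

Lemma weight_on_split F a b y z :
  weight_on F y z =
  weight_on (F :\ (a, b)) y z + weight_on F a b *+ ((y, z) == (a, b)).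
Proof.
rewrite /weight_on in_setD1; case: eqVneq => [[-> ->]|_] /=.
  by rewrite add0r mulr1n.
by rewrite mulr0n addr0.
Qed.

Lemma tree_poly_del x A :
  tree_poly G x A set0 = tree_sum (weight_on (edges G :\: A)) x.
Proof.
set F := edges G :\: A.
transitivity (\sum_(T in [set tree_arcs x f | f in parent_fun x] | T \subset F)
    \prod_(e in T) weight G e).
  apply: eq_bigl => T; rewrite sub0set andbT subsetD (disjoint_sym A).
  rewrite andbCA; congr (_ && _).
  apply/asboolP/imsetP => [/spanning_tree_parent_fun[f]|[f fP ->]].
    by exists f.
  exact: parent_fun_spanning_tree.
rewrite big_mkcondr /= big_imset /=; last exact: tree_arcs_inj.
apply: eq_bigr => f _.
have arcsE : tree_arcs x f = [set (v, f v) | v in predC1 x].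
  apply/setP => -[y z]; rewrite mem_tree_arcs; apply/andP/imsetP.
    by case=> yx /eqP->; exists y.
  by case=> v vx [-> ->].
case: ifPn => [/subsetP fF|/subsetPn[[y z]]].
  rewrite arcsE big_imset /= => [|u v _ _ []//]; apply: eq_bigr => v vx.
  by rewrite /weight_on fF // arcsE imset_f.
rewrite mem_tree_arcs => /andP[yx /eqP->] yF.
by rewrite (bigD1 y) //= /weight_on (negPf yF) mul0r.
Qed.

Lemma tree_poly_del_con x A e :
  tree_poly G x A set0 = tree_poly G x (e |: A) set0 + tree_poly G x A [set e].
Proof.
rewrite /tree_poly (bigID (fun T : {set X * X} => e \in T)) /= addrC.
congr (_ + _); apply: eq_bigl => T; rewrite ?sub0set ?sub1set ?andbT -?andbA //.
have -> : [disjoint e |: A & T] = (e \notin T) && [disjoint A & T].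
  by rewrite -disjointU1; apply: eq_disjoint => u; rewrite !inE.
by rewrite [_ && [disjoint _ & _]]andbC.
Qed.

End Polynomials.

(** * Coplanarity *)

Lemma plane_of_linear_relation (K : fieldType) (c : 'rV[K]_3) : c != 0 ->
  exists V : {vspace 'cV[K]_3},
    \dim V = 2%N /\ forall u, (u \in V) = (c *m u == 0).
Proof.
move=> c0; pose f : 'Hom('cV[K]_3, 'M[K]_1) := linfun (mulmx c).
have fE u : f u = c *m u by rewrite lfunE.
exists (lker f); split; last by move=> u; rewrite memv_ker fE.
have := limg_ker_dim f fullv; rewrite capfv dimvf /dim /= muln1.
suff -> : \dim (f @: fullv) = 1%N by rewrite addn1 => -[].
apply/anti_leq/andP; split.
  by apply: leq_trans (dimvS (subvf _)) _; rewrite dimvf /dim /= mul1n.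
rewrite lt0n dimv_eq0; apply: contra c0 => /eqP f0.
apply/eqP/rowP => i; rewrite mxE.
have : f (delta_mx i 0) \in (f @: fullv)%VS by rewrite memv_img ?memvf.
rewrite f0 memv0 fE => /eqP/matrixP/(_ 0 0); rewrite !mxE => <-.
rewrite (bigD1 i) //= big1 ?addr0 => [|k /negPf ki].
  by rewrite mxE !eqxx mulr1.
by rewrite mxE ki mulr0.
Qed.

Theorem theorem3 (R : realType) (X : finType) (G : wdigraph R X)
    (a b : X)
    (Girr : irreducible_graph G)
    (neq_ab : a != b)
    (abE : (a, b) \in edges G) (baE : (b, a) \in edges G)
    (ab_nbr : not_bridge G a b) :
  exists V : {vspace 'cV[R]_3},
    \dim V = 2%N /\ forall x : X, tree_vec G (a, b) (b, a) x \in V.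
Proof.
set p := (a, b); set m := (b, a).
pose w A := weight_on G (edges G :\: A).
pose u A x := tree_poly G x A set0.
have uE A : u A =1 tree_sum (w A) by move=> x; apply: tree_poly_del.
have flow A c d : exists j, forall y,
    net_inflow (w ((c, d) |: A)) (u A) y = j * ((y == c)%:R - (y == d)%:R).
  have -> : u A = tree_sum (w A) by apply/funext => x; apply: uE.
  apply: net_inflow_add_arc => x y; rewrite /w setUC -setDDl.
  exact: weight_on_split.
have [c [c_neq0 cE]] : exists c : R * R * R, c != 0 /\ forall x,
    c.1.1 * u [set p; m] x + c.1.2 * u [set m] x + c.2 * u [set p] x = 0.
  have [x0 ux0|u0] := pickP (fun x => u [set p; m] x != 0); last first.
    exists (1, 0, 0); split=> [|x]; first by rewrite !xpair_eqE oner_eq0.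
    by rewrite /= (eqP (negbFE (u0 x))) !mul0r mulr0 !addr0.
  (* Deleting the reverse arc exchanges the roles of the end points, whence the
     sign in front of j2. *)
  have [j1 j1E] := flow [set m] a b.
  have [j2 j2E] := flow [set p] b a.
  apply: (@dependent_measures _ _ (w [set p; m]) _ _ _ _ x0 j1 (- j2)
            (fun y => (y == a)%:R - (y == b)%:R)) => //.
  - by move=> y z; apply: weight_on_ge0; apply: subsetDl.
  - by apply: tree_sum_neq0; rewrite -uE.
  - move=> y; have -> : u [set p; m] = tree_sum (w [set p; m]).
      by apply/funext => x; apply: uE.
    exact: tree_sum_balance.
  - by move=> y; rewrite setUC j2E mulNr -mulrN opprB.
(* The relation between u0, u1, u2 in terms of the coordinates of tau_x, using
   u1 = u0 + tau^{del -1, con +1} and u2 = u0 + tau^{del +1, con -1}. *)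
pose C : 'rV[R]_3 := \row_i tnth [tuple c.1.1 + c.1.2 + c.2; c.1.2; c.2] i.
have C_neq0 : C != 0.
  apply: contra c_neq0 => /eqP/rowP C0.
  have := C0 0; have := C0 1; have := C0 2; rewrite !mxE /= !(tnth_nth 0) /=.
  case: (c) => -[c0 c1] c2 /= -> ->; rewrite !addr0 => ->.
  by [].
have [V [dimV VE]] := plane_of_linear_relation C_neq0.
exists V; split=> // x; rewrite VE; apply/eqP/matrixP => i j.
rewrite !mxE !big_ord_recl big_ord0 !mxE !(tnth_nth 0) /=.
rewrite -[RHS](cE x) /u.
rewrite (tree_poly_del_con G x [set m] p) (tree_poly_del_con G x [set p] m).
rewrite [m |: _]setUC !mulrDr !mulrDl addr0.
by rewrite -[RHS]addrA [in RHS]addrACA !addrA.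
Qed.
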